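(* For $n\geq 5$, let $f_n^1(\sigma)$ be the number of permutations $\pi\in\mathcal{S}_n$ with $\theta(\pi)=\pi$ that avoid $\sigma$. Then $f_n^1(\sigma)=F_{n+1}$ for $\sigma\in\{231,312,321\}$, $f_n^1(\sigma)=2$ for $\sigma\in\{132,213\}$, and $f_n^1(123)=0$.
   Context: $\mathcal{S}_n$ is the symmetric group on $[n]$, permutations in one-line notation $\pi_1\cdots\pi_n$. A permutation avoids a pattern $\tau$ if it has no subsequence order-isomorphic to $\tau$. The standard cycle notation of $\pi$ writes each cycle (fixed points included) with its largest element first and orders cycles by increasing largest element. The fundamental bijection $\theta:\mathcal{S}_n\to\mathcal{S}_n$ maps $\pi$ to the permutation whose one-line notation is obtained by erasing the parentheses of the standard cycle notation of $\pi$. Fibonacci numbers: $F_0=0$, $F_1=F_2=1$, $F_m=F_{m-1}+F_{m-2}$. *)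

(* Defs.v *)
From mathcomp Require Import all_boot all_fingroup.

Set Implicit Arguments.
Unset Strict Implicit.
Unset Printing Implicit Defensive.

(* Permutations of [n] are modelled as 'S_n, acting on 'I_n = {0, ..., n-1};
   shifting all values by one changes neither pattern containment nor the
   standard cycle notation. *)

Definition one_line (n : nat) (s : 'S_n) : seq 'I_n :=
  [seq s i | i <- enum 'I_n].

Definition cycle_max (n : nat) (s : 'S_n) (x : 'I_n) : bool :=
  [forall y in porbit s x, y <= x].

Definition cycle_from (n : nat) (s : 'S_n) (x : 'I_n) : seq 'I_n :=
  traject s x #|porbit s x|.

(* enum 'I_n is increasing, so the cycles come by increasing largest element;
   fixed points give cycles of length one. *)
Definition std_cycles (n : nat) (s : 'S_n) : seq (seq 'I_n) :=
  [seq cycle_from s x | x <- enum 'I_n & cycle_max s x].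

Definition theta_word (n : nat) (s : 'S_n) : seq 'I_n := flatten (std_cycles s).

Lemma mem_cycle_from (n : nat) (s : 'S_n) x y :
  (y \in cycle_from s x) = (y \in porbit s x).
Proof. by rewrite porbit_traject. Qed.

Lemma uniq_theta_word (n : nat) (s : 'S_n) : uniq (theta_word s).
Proof.
rewrite /theta_word /std_cycles.
have: uniq [seq x <- enum 'I_n | cycle_max s x] by rewrite filter_uniq ?enum_uniq.
have: all (cycle_max s) [seq x <- enum 'I_n | cycle_max s x] by exact: filter_all.
elim: [seq x <- _ | _] => //= x r IHr /andP[mx mr] /andP[xr ur].
rewrite cat_uniq uniq_traject_porbit IHr // andbT /=.
apply/hasPn => z /flatten_mapP[y ry]; rewrite mem_cycle_from => zy.
apply/negP => /=; rewrite mem_cycle_from => zx.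
have eq_xy : porbit s x = porbit s y.
  by move: zx zy; rewrite -!eq_porbit_mem => /eqP <- /eqP <-.
have my := allP mr _ ry.
suff exy : x = y by rewrite exy ry in xr.
apply/val_inj/eqP; rewrite /= eqn_leq.
move/forall_inP: mx => mx; move/forall_inP: my => my.
by rewrite my ?mx // ?eq_xy ?porbit_id // -eq_xy porbit_id.
Qed.

Lemma mem_theta_word (n : nat) (s : 'S_n) x : x \in theta_word s.
Proof.
have [y xy ymax] := @arg_maxnP _ x (fun y => y \in porbit s x) val (porbit_id s x).
have eq_xy : porbit s y = porbit s x by apply/eqP; rewrite eq_porbit_mem.
apply/flatten_mapP; exists y; last by rewrite mem_cycle_from eq_xy porbit_id.
rewrite mem_filter mem_enum andbT; apply/forall_inP => z.
by rewrite eq_xy => /ymax.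
Qed.

Lemma size_theta_word (n : nat) (s : 'S_n) : size (theta_word s) = n.
Proof.
rewrite -(card_uniqP (uniq_theta_word s)) -[RHS]card_ord.
by apply: eq_card => x; rewrite mem_theta_word.
Qed.

Lemma theta_inj (n : nat) (s : 'S_n) :
  injective (fun i : 'I_n => nth i (theta_word s) i).
Proof.
move=> i j; rewrite (set_nth_default j) ?size_theta_word // => /eqP.
by rewrite nth_uniq ?size_theta_word ?uniq_theta_word // => /eqP/val_inj.
Qed.

Definition theta (n : nat) (s : 'S_n) : 'S_n := perm (@theta_inj n s).

Lemma one_line_theta (n : nat) (s : 'S_n) : one_line (theta s) = theta_word s.
Proof.
have sz : size (one_line (theta s)) = n by rewrite size_map size_enum_ord.
case: n s sz => [|n] s sz.
  by rewrite (size0nil sz) (size0nil (size_theta_word s)).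
apply: (@eq_from_nth _ ord0) => [|i]; rewrite sz ?size_theta_word // => ltin.
rewrite (nth_map ord0) ?size_enum_ord // permE nth_enum_ord //.
by apply: set_nth_default; rewrite size_theta_word.
Qed.

Definition order_iso (u v : seq nat) : bool :=
  (size u == size v) &&
  [forall i : 'I_(size u), forall j : 'I_(size u),
     (nth 0 u i < nth 0 u j) == (nth 0 v i < nth 0 v j)].

(* The subsequences of a word of length n are its masks by n-bit vectors. *)
Definition contains (n : nat) (s : 'S_n) (tau : seq nat) : bool :=
  [exists m : n.-tuple bool,
     order_iso (mask m [seq val x | x <- one_line s]) tau].

Definition avoids (n : nat) (s : 'S_n) (tau : seq nat) : bool :=
  ~~ contains s tau.

Lemma containsP (n : nat) (s : 'S_n) (tau : seq nat) :
  reflect (exists2 u, subseq u [seq val x | x <- one_line s] & order_iso u tau)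
          (contains s tau).
Proof.
apply: (iffP existsP) => [[m mP]|[u /subseqP[m szm ->] uP]].
  by eexists; last exact: mP; exact: mask_subseq.
have szmn : size m == n by rewrite szm 2!size_map size_enum_ord.
by exists (Tuple szmn).
Qed.

Definition fixed_avoiders (n : nat) (tau : seq nat) : nat :=
  #|[set s : 'S_n | (theta s == s) && avoids s tau]|.

Fixpoint fib (m : nat) : nat :=
  match m with
  | 0 => 0
  | 1 => 1
  | (k.+1 as k').+1 => fib k' + fib k
  end.

(* Main.v *)
Require Import Defs.
From mathcomp Require Import all_boot all_fingroup.
From mathcomp Require Import zify.

(** If the cycle (x, s x, s^2 x, ...) is written from position p on in the
    standard cycle notation and theta s = s, then s (p + j) = s^j x.  Injectivity
    of s forces the cycle to be (p) or (p+1, p), so the fixed points of theta are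
    exactly the involutions moving every point by at most one, i.e. the direct
    sums of blocks 1 and 21; there are fib n.+1 of them.  Their inversions are
    pairs of adjacent positions, so 231, 312 and 321 never occur, while 132 (resp.
    213) occurs as soon as some block 21 is not first (resp. last), and positions
    0, 2, 4 always carry the pattern 123. *)

Set Implicit Arguments.
Unset Strict Implicit.
Unset Printing Implicit Defensive.

(** * Involutions moving every point by at most one, and their cycles *)

Definition near_involution (n : nat) (s : 'S_n) : bool :=
  [forall i, [&& s (s i) == i, s i <= i.+1 & i <= (s i).+1]].

Lemma near_involutionP (n : nat) (s : 'S_n) :
  reflect (forall i, [/\ s (s i) = i, s i <= i.+1 & i <= (s i).+1])
          (near_involution s).
Proof.
apply: (iffP forallP) => H i; first by case/and3P: (H i) => /eqP.
by apply/and3P; case: (H i) => -> ? ?.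
Qed.

Lemma involutive_porbit (T : finType) (s : {perm T}) (x : T) :
  s (s x) = x -> porbit s x = [set x; s x].
Proof.
move=> ssx; apply/setP => y; rewrite !inE; apply/porbitP/orP => [[i ->]|].
  elim: i => [|i IH]; first by left; rewrite expg0 perm1.
  rewrite expgSr permM.
  by case: IH => /eqP ->; [right | left; rewrite ssx].
by case=> /eqP ->; [exists 0; rewrite expg0 perm1 | exists 1; rewrite expg1].
Qed.

Lemma involutive_cycle_from (n : nat) (s : 'S_n) (x : 'I_n) :
  s (s x) = x -> cycle_from s x = if s x == x then [:: x] else [:: x; s x].
Proof.
move=> ssx; rewrite /cycle_from involutive_porbit // cards2 eq_sym.
by case: eqP.
Qed.

Lemma involutive_cycle_max (n : nat) (s : 'S_n) (x : 'I_n) :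
  s (s x) = x -> cycle_max s x = (s x <= x).
Proof.
move=> ssx; rewrite /cycle_max involutive_porbit //.
apply/forall_inP/idP => [H|le y]; first by apply: H; rewrite !inE eqxx orbT.
by rewrite !inE => /orP[] /eqP ->.
Qed.

(** * Fixed points of [theta] are such involutions *)

Lemma cycle_maxW (n : nat) (s : 'S_n) (i : 'I_n) :
  exists2 x, cycle_max s x & i \in porbit s x.
Proof.
have /flatten_mapP[x] := mem_theta_word s i.
by rewrite mem_filter mem_cycle_from => /andP[mx _]; exists x.
Qed.

(** Here [p] is the total length of the cycles listed before that of [x]; the bound keeps every
    [p + j] a legal position. *)
Lemma nth_theta_word (n : nat) (s : 'S_n) (x : 'I_n) : cycle_max s x ->
  exists p, p + #|porbit s x| <= n /\
    forall j, j < #|porbit s x| -> nth x (theta_word s) (p + j) = iter j s x.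
Proof.
move=> mx; have : x \in [seq x <- enum 'I_n | cycle_max s x].
  by rewrite mem_filter mx mem_enum.
have := size_theta_word s; rewrite /theta_word /std_cycles.
move=> sz /path.splitPr e; case: e sz => r1 r2.
rewrite map_cat flatten_cat /= !size_cat size_traject => sz.
exists (size (flatten [seq cycle_from s x | x <- r1])); split; first by rewrite -[X in _ <= X]sz addnA leq_addr.
move=> j ltj; rewrite nth_cat ltnNge leq_addr /= addKn nth_cat size_traject ltj.
by rewrite nth_traject.
Qed.

Lemma nth_one_line (n : nat) (s : 'S_n) (x i : 'I_n) : nth x (one_line s) i = s i.
Proof. by rewrite (nth_map x) ?size_enum_ord // nth_ord_enum. Qed.

(* If the cycle of x starts at position p of the word, then s (p + j) = s^j x;
   injectivity of s makes x = p + 1 when the length is at least 2, and a third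
   letter would be p + 2, exceeding the maximum x. *)
Lemma fixed_theta_near_involution (n : nat) (s : 'S_n) :
  theta s = s -> near_involution s.
Proof.
move=> fs; apply/near_involutionP => i.
have [x mx ix] := cycle_maxW s i.
have [p [lep nthp]] := nth_theta_word mx.
have sp j (lt_pj : p + j < n) : j < #|porbit s x| ->
    s (Ordinal lt_pj) = iter j s x.
  by move=> ltj; rewrite -nthp // -one_line_theta fs -(nth_one_line s x).
have it := iter_porbit s x.
have k0 : 0 < #|porbit s x| by apply/card_gt0P; exists x; exact: porbit_id.
have lt0 : p + 0 < n by lia.
have s0 := sp _ lt0 k0.
move: ix; rewrite -mem_cycle_from /cycle_from.
case: (ltnP 1 #|porbit s x|) => k1; last first.
  have k : #|porbit s x| = 1 by lia.
  rewrite k /= in it *; rewrite inE => /eqP ->.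
  by rewrite !it; split => //; lia.
have lt1 : p + 1 < n by lia.
have s1 := sp _ lt1 k1.
have /perm_inj x1 : s (Ordinal lt1) = s x by [].
case: (ltnP 2 #|porbit s x|) => k2.
  have lt2 : p + 2 < n by lia.
  have s2 := sp _ lt2 k2.
  have /perm_inj x2 : s (Ordinal lt2) = s (s x) by [].
  have : s x <= x by move/forall_inP: mx; apply; rewrite (mem_porbit s 1).
  by rewrite -x2 -x1 /=; lia.
have k : #|porbit s x| = 2 by lia.
rewrite k /= in it *.
(* In length two, [s] sends both position [p] and [s x] to [x], so [s x] is [p]. *)
have /perm_inj x0 : s (Ordinal lt0) = s (s x) by rewrite s0 it.
have vx : x = p.+1 :> nat by rewrite -x1 /= addn1.
have vsx : s x = p :> nat by rewrite -x0 /= addn0.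
rewrite !inE => /orP[] /eqP ->; rewrite !it; split => //; lia.
Qed.

(** * Such involutions are fixed by [theta] *)

(** With empty blocks in place of the filter, the word becomes a flattening over a full initial
    segment, where induction on the length applies. *)
Lemma flatten_map_filter (T S : Type) (P : pred T) (F : T -> seq S) (r : seq T) :
  flatten [seq F x | x <- r & P x] =
  flatten [seq if P x then F x else [::] | x <- r].
Proof. by elim: r => //= x r IH; case: (P x) => /=; rewrite IH. Qed.

(* When f m = m + 1, the cycle of m is only listed at m + 1, so the word so far
   stops one letter short. *)
Lemma near_involution_word (f : nat -> nat) (m : nat) :
  (forall i, i < m -> [/\ f (f i) = i, f i <= i.+1 & i <= (f i).+1]) ->
  flatten [seq if f i <= i then if f i == i then [:: i] else [:: i; f i]
               else [::] | i <- iota 0 m] =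
  [seq f i | i <- iota 0 (if f m.-1 <= m.-1 then m else m.-1)].
Proof.
elim: m => [|m IH] H; first by case: ifP.
have {}IH := IH (fun i lt => H i (ltnW lt)).
rewrite -addn1 iotaD map_cat flatten_cat {}IH addn1 /= cats0 add0n.
have [ffm le1 le2] := H m (leqnn _).
case: (ltngtP (f m) m) => [lt|gt|eqm].
- case: m H ffm le1 le2 lt => [//|m] H ffm le1 le2 lt.
  (* The new cycle [m.+1, m] reads [f m, f m.+1]: it also supplies the letter missing so far. *)
  have fm : f m.+1 = m by lia.
  rewrite fm in ffm *; rewrite -[m.+1.-1]/m.
  have -> : (f m <= m) = false by lia.
  by rewrite -[m.+2]addn2 iotaD map_cat /= add0n ffm fm.
- case: m H ffm le1 le2 gt => [|m] H ffm le1 le2 gt; first by rewrite cats0; case: ifP.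
  rewrite cats0 /=; case: ifP => // fm.
  have [] := H m (ltnW (ltnSn _)); move=> ffm' l1 l2.
  have e : f m = m.+1 by lia.
  by rewrite e in ffm'; lia.
- have -> : (if f m.-1 <= m.-1 then m else m.-1) = m.
    case: ifP => //; case: m H ffm le1 le2 eqm => [//|m] H ffm le1 le2 eqm /= fm.
    have [] := H m (ltnW (ltnSn _)); move=> ffm' l1 l2.
    have e : f m = m.+1 by lia.
    by rewrite e in ffm'; lia.
  by rewrite -addn1 iotaD map_cat /= add0n eqm.
Qed.

Lemma near_involution_fixed_theta (n : nat) (s : 'S_n) :
  near_involution s -> theta s = s.
Proof.
move=> /near_involutionP H.
suff e : theta_word s = one_line s.
  by apply/permP => i; rewrite -!(nth_one_line _ i) one_line_theta e.
case: n s H => [|n] s H.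
  have sz : size (one_line s) = 0 by rewrite size_map size_enum_ord.
  by rewrite (size0nil sz) (size0nil (size_theta_word s)).
apply: (inj_map val_inj); rewrite /theta_word /std_cycles flatten_map_filter.
pose f k := val (s (inord k)).
have fE (i : 'I_n.+1) : f i = val (s i) by rewrite /f inord_val.
rewrite map_flatten -map_comp.
rewrite (@eq_map _ _ _ ((fun i => if f i <= i then
    if f i == i then [:: i] else [:: i; f i] else [::]) \o val)); last first.
  move=> x /=; have [ssx _ _] := H x.
  rewrite involutive_cycle_max // involutive_cycle_from // fE.
  by case: ifP => // _; rewrite -val_eqE /=; case: eqP.
rewrite map_comp val_enum_ord near_involution_word; last first.
  move=> i lti; have [ssi ? ?] := H (Ordinal lti).
  by rewrite (fE (Ordinal lti)) fE ssi.
(* The last index cannot move up, so no letter is missing at the end. *)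
have fn : f n <= n by exact: leq_ord.
rewrite fn.
rewrite -val_enum_ord -!map_comp; apply: eq_map => i /=; exact: fE.
Qed.

Lemma fixed_theta (n : nat) (s : 'S_n) : (theta s == s) = near_involution s.
Proof.
apply/eqP/idP; [exact: fixed_theta_near_involution|exact: near_involution_fixed_theta].
Qed.

(** * Counting by Fibonacci numbers *)

(** Direct sums of blocks 1 and 21, split by their last block. That block carries the largest
    values, so the prefix needs no relabelling. *)
Fixpoint domino_words (n : nat) : seq (seq nat) :=
  match n with
  | 0 => [:: [::]]
  | 1 => [:: [:: 0]]
  | (k.+1 as k').+1 => [seq rcons w k' | w <- domino_words k'] ++
                       [seq rcons (rcons w k') k | w <- domino_words k]
  end.

Lemma nat_ind2 (P : nat -> Prop) :
  P 0 -> P 1 -> (forall n, P n -> P n.+1 -> P n.+2) -> forall n, P n.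
Proof.
move=> P0 P1 PS n; suff [] : P n /\ P n.+1 by [].
by elim: n => [|n [IH1 IH2]]; split => //; apply: PS.
Qed.

Lemma size_domino_words (n : nat) : size (domino_words n) = fib n.+1.
Proof.
elim/nat_ind2: n => // n IH1 IH2.
by rewrite [domino_words _]/= size_cat !size_map IH1 IH2.
Qed.

Lemma uniq_domino_words (n : nat) : uniq (domino_words n).
Proof.
elim/nat_ind2: n => // n IH1 IH2.
rewrite [domino_words _]/= cat_uniq !map_inj_uniq ?IH1 ?IH2; last 2 first.
- by move=> u v /rcons_inj[/rcons_inj[]].
- exact: rcons_injl.
rewrite andbT; apply/hasPn => w /mapP[u _ ->]; apply/negP => /mapP[v _].
by move=> /rcons_inj[_]; lia.
Qed.

(** The explicit range condition guards against the default value of [nth]: without it [[:: 1]]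
    would qualify. *)
Definition near_involution_seq (w : seq nat) : Prop :=
  forall i, i < size w ->
    [/\ nth 0 w (nth 0 w i) = i, nth 0 w i < size w,
        nth 0 w i <= i.+1 & i <= (nth 0 w i).+1].

(** For length [n.+2] the last letter is [n.+1], a block 1, or [n], and then involutivity makes the
    letter before it [n.+1], a block 21. Removing this block leaves a word of the same kind. *)
Lemma mem_domino_words (n : nat) (w : seq nat) :
  w \in domino_words n <-> size w = n /\ near_involution_seq w.
Proof.
elim/nat_ind2: n w => [||n IH1 IH2] w.
- rewrite inE; split => [/eqP ->|[/size0nil -> _]] //.
- rewrite inE; split => [/eqP ->|[]]; first by split => // -[].
  case: w => [//|a []] //= _ /(_ 0 isT) [] /= _.
  by case: a.
rewrite [domino_words _]/= mem_cat; split.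
  case/orP => /mapP[u]; [move/IH2|move/IH1] => -[su Hu] ->.
    split=> [|i]; rewrite size_rcons su // ltnS leq_eqVlt.
    rewrite !nth_rcons su => /orP[/eqP->|lti].
      by rewrite ltnn eqxx ltnn eqxx.
    by rewrite lti; have := Hu i; rewrite su => /(_ lti) [-> -> *]; split => //; lia.
  split=> [|i]; rewrite !size_rcons su //.
  case: (ltngtP i n) => [lti _|gt lt|-> _].
  - have := Hu i; rewrite su => /(_ lti) [e lt *].
    rewrite !nth_rcons size_rcons su lti (leqW lti) lt (leqW lt).
    by split => //; lia.
  - have -> : i = n.+1 by lia.
    rewrite !nth_rcons size_rcons su ltnn eqxx leqnn ltnn eqxx.
    by split => //; lia.
  - rewrite !nth_rcons size_rcons su ltnn eqxx leqnn ltnn eqxx.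
    by split => //; lia.
case=> sw Hw; move: (sw).
case/lastP: w sw Hw => [//|w a] _ Hw; rewrite size_rcons => -[sw].
have := Hw n.+1; rewrite size_rcons sw => /(_ (leqnn _)).
rewrite !nth_rcons sw ltnn eqxx => -[ea la _ ga].
case: (ltngtP a n.+1) ea => [lta ea|gta|ea' _]; last 1 first.
- subst a; apply/orP; left; apply/mapP; exists w => //.
  apply/IH2; split=> // i lti; have := Hw i.
  rewrite size_rcons !nth_rcons lti leqW // => /(_ isT).
  (* A letter [n.+1] before the end would be sent to [n.+1] and not back to [i]. *)
  case: (ltngtP (nth 0 w i) (size w)) => [lt|gt|_]; last by case=> /= *; lia.
    by case=> *; split.
  by case=> *; lia.
- have {lta ga la} ea' : a = n by lia.
  subst a; case/lastP: w Hw sw ea => [//|w b] Hw.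
  rewrite size_rcons => -[sw]; rewrite nth_rcons sw ltnn eqxx => eb; subst b.
  apply/orP; right; apply/mapP; exists w => //.
  apply/IH1; split=> // i lti; have := Hw i.
  rewrite !size_rcons !nth_rcons !size_rcons sw.
  rewrite sw in lti; rewrite lti !ltnS (leqW (ltnW lti)) (ltnW lti) => /(_ isT).
  case: (ltngtP (nth 0 w i) n) => [lt|gt|eqn].
  + by case.
  + by case=> *; lia.
  + by case=> /= *; lia.
- by lia.
Qed.

(** * From permutations to words of natural numbers *)

Definition nat_word (n : nat) (s : 'S_n) : seq nat := [seq val x | x <- one_line s].

Lemma size_nat_word (n : nat) (s : 'S_n) : size (nat_word s) = n.
Proof. by rewrite 2!size_map size_enum_ord. Qed.

Lemma nth_nat_word (n : nat) (s : 'S_n) (i : 'I_n) : nth 0 (nat_word s) i = s i.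
Proof. by rewrite (nth_map i) ?nth_one_line // size_map size_enum_ord. Qed.

Lemma nat_word_inj (n : nat) : injective (@nat_word n).
Proof.
by move=> s t e; apply/permP => i; apply: val_inj; rewrite /= -!nth_nat_word e.
Qed.

Lemma near_involution_nat_word (n : nat) (s : 'S_n) :
  near_involution s <-> near_involution_seq (nat_word s).
Proof.
split=> [/near_involutionP H i|H].
  rewrite size_nat_word => lti; rewrite -[i]/(val (Ordinal lti)) !nth_nat_word.
  by have [-> *] := H (Ordinal lti).
apply/near_involutionP => i; have := H i.
rewrite size_nat_word !nth_nat_word => /(_ (ltn_ord i)) [e _ ? ?].
by split => //; apply: val_inj.
Qed.

(** A self-inverse map is injective, so the letters of [w] define a permutation. *)
Lemma near_involution_seq_perm (w : seq nat) : near_involution_seq w ->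
  exists s : 'S_(size w), nat_word s = w.
Proof.
move=> H.
have lt (i : 'I_(size w)) : nth 0 w i < size w by have [] := H i (ltn_ord i).
have inj : injective (fun i => Ordinal (lt i)).
  move=> i j [e]; apply: val_inj => /=.
  have [<- _ _ _] := H i (ltn_ord i); rewrite e.
  by have [] := H j (ltn_ord j).
exists (perm inj); apply: (@eq_from_nth _ 0); rewrite size_nat_word // => i lti.
by rewrite -[i]/(val (Ordinal lti)) nth_nat_word permE.
Qed.

Lemma card_near_involution (n : nat) :
  #|[set s : 'S_n | near_involution s]| = fib n.+1.
Proof.
rewrite cardE -(size_map (@nat_word n)) -size_domino_words.
apply/perm_size/uniq_perm.
- by rewrite map_inj_uniq ?enum_uniq //; exact: nat_word_inj.
- exact: uniq_domino_words.
move=> w; apply/mapP/idP => [[s]|/mem_domino_words [sw Hw]].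
  rewrite mem_enum inE => /near_involution_nat_word H ->.
  by apply/mem_domino_words; rewrite size_nat_word.
have [s es] := near_involution_seq_perm Hw; subst n.
exists s => //; rewrite mem_enum inE.
by apply/near_involution_nat_word; rewrite es.
Qed.

(** * Patterns of length three as triples of positions *)

Lemma order_iso3 (x y z a b c : nat) :
  order_iso [:: x; y; z] [:: a; b; c] =
  [&& (x < y) == (a < b), (x < z) == (a < c), (y < z) == (b < c),
      (y < x) == (b < a), (z < x) == (c < a) & (z < y) == (c < b)].
Proof.
rewrite /order_iso /=; apply/idP/idP => [/forallP H|H].
  pose o k : 'I_3 := inord k; have {}H i j := forallP (H (o i)) (o j).
  have := H 0 1; have := H 0 2; have := H 1 2.
  have := H 1 0; have := H 2 0; have := H 2 1.
  by rewrite !inordK //= => -> -> -> -> -> ->.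
case/and5P: H => h1 h2 h3 h4 /andP[h5 h6].
apply/forallP => -[[|[|[|//]]] ?]; apply/forallP => -[[|[|[|//]]] ?] //=;
  by rewrite !ltnn.
Qed.

(** A strictly increasing sequence is determined by its set of members, hence is the filter of the
    enumeration by that set. *)
Lemma subseq_enum_ord (n : nat) (u : seq 'I_n) :
  subseq u (enum 'I_n) = sorted ltn [seq val i | i <- u].
Proof.
have se : sorted ltn [seq val i | i <- enum 'I_n] by rewrite val_enum_ord iota_ltn_sorted.
apply/idP/idP => [sub|su].
  exact: (subseq_sorted ltn_trans (map_subseq _ sub) se).
rewrite sorted_map in su; rewrite sorted_map in se.
have irr : irreflexive (relpre (@nat_of_ord n) ltn) by move=> x /=; rewrite ltnn.
have tr : transitive (relpre (@nat_of_ord n) ltn) by move=> x y z; apply: ltn_trans.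
suff -> : u = [seq x <- enum 'I_n | x \in u] by exact: filter_subseq.
apply: (irr_sorted_eq tr irr su (sorted_filter tr _ se)).
by move=> x; rewrite mem_filter mem_enum andbT.
Qed.

Lemma contains3P (n : nat) (s : 'S_n) (a b c : nat) :
  reflect (exists i j k : 'I_n,
             i < j < k /\ order_iso [:: val (s i); val (s j); val (s k)] [:: a; b; c])
          (contains s [:: a; b; c]).
Proof.
apply: (iffP (containsP s _)) => [[u]|[i [j [k [/andP[ij jk] iso]]]]]; last first.
  exists [:: val (s i); val (s j); val (s k)] => //.
  apply: (map_subseq val (s1 := [:: s i; s j; s k])).
  by apply: (map_subseq s (s1 := [:: i; j; k])); rewrite subseq_enum_ord /= ij jk.
case/subseqP => m _ ->; rewrite /one_line -2!map_mask.
have := mask_subseq m (enum 'I_n); rewrite subseq_enum_ord.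
case: (mask m _) => [|i [|j [|k [|l v]]]] lt iso;
  try by move: iso; rewrite /order_iso => /andP[].
by exists i, j, k; rewrite -[i < j < k]andbT -andbA.
Qed.

(** * Inversions, and the patterns 231, 312 and 321 *)

(** The chain [j - 1 <= s j < s i <= i + 1] leaves no other room. *)
Lemma near_involution_inversion (n : nat) (s : 'S_n) (i j : 'I_n) :
  near_involution s -> i < j -> s j < s i -> j = i.+1 :> nat /\ s i = i.+1 :> nat.
Proof.
move=> /near_involutionP H lt inv.
by have [_ ? ?] := H i; have [_ ? ?] := H j; lia.
Qed.

(** With [c < a], an occurrence would invert its outer positions, which are at distance at least
    two. *)
Lemma near_involution_avoids (n : nat) (s : 'S_n) (a b c : nat) :
  near_involution s -> c < a -> avoids s [:: a; b; c].
Proof.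
move=> ns ca; apply/contains3P => -[i [j [k [/andP[ij jk]]]]].
rewrite order_iso3 ca => /and5P[_ _ _ _ /andP[/eqP inv _]].
by have [] := near_involution_inversion ns (ltn_trans ij jk) inv; lia.
Qed.

(** * The two avoiders of 132 and of 213 *)

Lemma tperm_near_involution (n : nat) (a b : 'I_n) :
  b = a.+1 :> nat -> near_involution (tperm a b).
Proof.
move=> ab; apply/near_involutionP => i; rewrite tpermK /=.
by case: tpermP => [->|->|_ _]; split => //; lia.
Qed.

(** The last hypothesis says that a block 21 can start only at [a]. *)
Lemma near_involution_eq_tperm (n : nat) (s : 'S_n) (a b : 'I_n) :
  b = a.+1 :> nat -> near_involution s ->
  (forall i, s i = i.+1 :> nat -> i = a) -> s = 1%g \/ s = tperm a b.
Proof.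
move=> ab /near_involutionP H up.
(* A point moved up is [a]; a point moved down is the image of one moved up, hence is [b]. *)
have fix_out i : i != a -> i != b -> s i = i.
  move=> ia ib; have [ssi le1 le2] := H i; apply: val_inj => /=.
  case: (ltngtP (s i) i) => // [lt|gt].
    have e : s i = a by apply: up; rewrite ssi /=; lia.
    by case/eqP: ib; apply: val_inj => /=; rewrite e in le2 lt; lia.
  by case/eqP: ia; apply: up => /=; lia.
have [ssa a1 a2] := H a; have [ssb b1 b2] := H b.
have nab : a != b by apply/eqP => e; rewrite e in ab; lia.
case: (eqVneq (s a) b) => [sab|sab].
  right; apply/permP => i; case: tpermP => [->|->|/eqP ia /eqP ib] //.
    by rewrite -sab ssa.
  exact: fix_out.
left; apply/permP => i; rewrite perm1.
have saa : s a = a.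
  case: (eqVneq (s a) a) => // saa.
  by have := fix_out _ saa sab; rewrite ssa => e; rewrite -e eqxx in saa.
case: (eqVneq i a) => [-> //|ia]; case: (eqVneq i b) => [->|]; last exact: fix_out.
case: (eqVneq (s b) b) => // sbb; case: (eqVneq (s b) a) => sba.
  by rewrite -sba ssb in saa; rewrite saa sba eqxx in nab.
by have := fix_out _ sba sbb; rewrite ssb => e; rewrite -e eqxx in sbb.
Qed.

Lemma near_involution1 (n : nat) : near_involution (1%g : 'S_n).
Proof. by apply/near_involutionP => i; rewrite !perm1; split => //; lia. Qed.

Lemma fixed_avoiders_eq2 (n : nat) (a b : 'I_n) (tau : seq nat) :
  b = a.+1 :> nat -> avoids (1%g : 'S_n) tau -> avoids (tperm a b) tau ->
  (forall (s : 'S_n) i, near_involution s -> avoids s tau ->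
     s i = i.+1 :> nat -> i = a) ->
  fixed_avoiders n tau = 2.
Proof.
move=> ab av1 avt up; rewrite /fixed_avoiders.
have -> : [set s : 'S_n | (theta s == s) && avoids s tau] = [set 1%g; tperm a b].
  apply/setP => s; rewrite !inE fixed_theta; apply/andP/orP => [[ns av]|].
    by have [->|->] := near_involution_eq_tperm ab ns (fun i => up s i ns av);
      [left|right].
  by case=> /eqP ->; rewrite ?near_involution1 ?tperm_near_involution.
rewrite cards2; case: eqP => // /permP /(_ a); rewrite perm1 tpermL => e.
by rewrite -e in ab; lia.
Qed.

Lemma tperm_up (n : nat) (a b i : 'I_n) :
  b = a.+1 :> nat -> tperm a b i = i.+1 :> nat -> i = a.
Proof.
move=> ab; case: tpermP => [->|->|_ _] // e; lia.
Qed.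

Lemma avoids1_132 (n : nat) : avoids (1%g : 'S_n) [:: 1; 3; 2].
Proof.
apply/contains3P => -[i [j [k [/andP[ij jk]]]]].
by rewrite order_iso3 !perm1 /=; lia.
Qed.

Lemma avoids1_213 (n : nat) : avoids (1%g : 'S_n) [:: 2; 1; 3].
Proof.
apply/contains3P => -[i [j [k [/andP[ij jk]]]]].
by rewrite order_iso3 !perm1 /=; lia.
Qed.

Lemma avoids_tperm_132 (n : nat) (a b : 'I_n) :
  a = 0 :> nat -> b = 1 :> nat -> avoids (tperm a b) [:: 1; 3; 2].
Proof.
move=> a0 b1; have ab : b = a.+1 :> nat by rewrite b1 a0.
apply/contains3P => -[i [j [k [/andP[ij jk]]]]].
rewrite order_iso3 => /and5P[_ _ _ _ /andP[_ /eqP inv]].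
have [_ /(tperm_up ab) ja] := near_involution_inversion (tperm_near_involution ab) jk inv.
by rewrite ja in ij; lia.
Qed.

Lemma avoids_tperm_213 (n : nat) (a b : 'I_n) :
  b = a.+1 :> nat -> b.+1 = n -> avoids (tperm a b) [:: 2; 1; 3].
Proof.
move=> ab bn; apply/contains3P => -[i [j [k [/andP[ij jk]]]]].
rewrite order_iso3 => /and5P[_ _ _ /eqP inv _].
have [e /(tperm_up ab) ia] := near_involution_inversion (tperm_near_involution ab) ij inv.
by rewrite ia in e; have := ltn_ord k; lia.
Qed.

Lemma near_involution_avoids_132_up (n : nat) (s : 'S_n) (i z : 'I_n) :
  near_involution s -> avoids s [:: 1; 3; 2] -> s i = i.+1 :> nat ->
  z = 0 :> nat -> i = z.
Proof.
move=> /near_involutionP H av up z0; apply/val_inj/eqP; rewrite /= z0.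
apply/negPn/negP => i0; case/negP: av; apply/contains3P.
have [ssi _ _] := H i; have [ssz le _] := H z.
(* Positions [0, i, i + 1] carry [s z, i + 1, i], and [s z < i] since [s z <= 1] and [s z] differs
   from [i]. *)
exists z, i, (s i); rewrite order_iso3 ssi /= up z0.
have zi : s z <> i :> nat.
  by move/val_inj => e; rewrite -e ssz in up; rewrite e in up; lia.
by split; lia.
Qed.

Lemma near_involution_avoids_213_up (n : nat) (s : 'S_n) (i z : 'I_n) :
  near_involution s -> avoids s [:: 2; 1; 3] -> s i = i.+1 :> nat ->
  z = n.-2 :> nat -> i = z.
Proof.
move=> /near_involutionP H av up zn; apply/val_inj/eqP; rewrite /= zn.
apply/negPn/negP => i0; case/negP: av; apply/contains3P.
have [ssi _ _] := H i; have lts := ltn_ord (s i).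
(* A block 21 that is not last leaves room for position [i + 2], whose value exceeds [i + 1] and
   completes 213. *)
have ltk : i.+2 < n by lia.
have [ssk le ge] := H (Ordinal ltk).
have ki : s (Ordinal ltk) <> s i :> nat.
  by move/val_inj/perm_inj => /(congr1 val) /=; lia.
exists i, (s i), (Ordinal ltk); rewrite order_iso3 ssi /= up.
by rewrite /= in ge; split; lia.
Qed.

(** * The pattern 123, and the final counts *)

Lemma near_involution_contains_123 (n : nat) (s : 'S_n) :
  5 <= n -> near_involution s -> contains s [:: 1; 2; 3].
Proof.
move=> n5 /near_involutionP H; apply/contains3P.
have l0 : 0 < n by lia.
have l2 : 2 < n by lia.
have l4 : 4 < n by lia.
exists (Ordinal l0), (Ordinal l2), (Ordinal l4); split=> //.
(* The values at 0, 2, 4 satisfy [s 0 <= 1 <= s 2 <= 3 <= s 4]; injectivity makes them strictly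
   increasing. *)
have ne (x y : 'I_n) : s x = s y :> nat -> x = y :> nat by move/val_inj/perm_inj->.
have := ne (Ordinal l0) (Ordinal l2); have := ne (Ordinal l2) (Ordinal l4).
have [_ + _] := H (Ordinal l0); have [_ + +] := H (Ordinal l2).
by have [_ _ +] := H (Ordinal l4); rewrite order_iso3 /=; lia.
Qed.

Unset Implicit Arguments.

Theorem theorem5p1 (n : nat) (hn : 5 <= n) :
  [/\ forall sigma : seq nat,
        sigma \in [:: [:: 2; 3; 1]; [:: 3; 1; 2]; [:: 3; 2; 1]] ->
        fixed_avoiders n sigma = fib n.+1,
      forall sigma : seq nat,
        sigma \in [:: [:: 1; 3; 2]; [:: 2; 1; 3]] ->
        fixed_avoiders n sigma = 2
    & fixed_avoiders n [:: 1; 2; 3] = 0].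
Proof.
split=> [sigma|sigma|].
- rewrite !inE -card_near_involution => Hs; apply: eq_card => s.
  rewrite !inE fixed_theta; case: (boolP (near_involution s)) => //= ns.
  by case/or3P: Hs => /eqP ->; apply: near_involution_avoids.
- have l0 : 0 < n by lia.
  have l1 : 1 < n by lia.
  have m2 : n.-2 < n by lia.
  have m1 : n.-1 < n by lia.
  have mm : n.-1 = n.-2.+1 by lia.
  (* Besides the identity, the avoider swaps the first two positions for 132 and the last two for
     213. *)
  rewrite !inE => /orP[] /eqP ->.
    apply: (@fixed_avoiders_eq2 n (Ordinal l0) (Ordinal l1)) => //.
    + exact: avoids1_132.
    + exact: avoids_tperm_132.
    + by move=> s i ns av up; apply: near_involution_avoids_132_up av up _.
  apply: (@fixed_avoiders_eq2 n (Ordinal m2) (Ordinal m1)) => //.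
  + exact: avoids1_213.
  + by apply: avoids_tperm_213 => //=; lia.
  + by move=> s i ns av up; apply: near_involution_avoids_213_up av up _.
- apply: eq_card0 => s; rewrite !inE fixed_theta; apply/negP => /andP[ns].
  by rewrite /avoids near_involution_contains_123.
Qed.
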